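(* Consider a sequence (indexed by $n\to\infty$) of attributed Erdős–Rényi pairs $\mathcal{G}(n,\bm p;m,\bm q)$, where $m$, $\bm p$, $\bm q$ may depend on $n$. If $$-n\log(1-2p_{11}+2p_{11}^2)-m\log(1-2q_{11}+2q_{11}^2)-2\log n\to-\infty\quad(n\to\infty),$$ then for any estimator the probability of error is bounded away from zero: for any sequence of estimators $\hat\pi$, $\liminf_{n\to\infty}\mathsf P(\hat\pi(G_1,G_2')\neq\Pi^* )>0$.
   Context: Attributed Erdős–Rényi pair $\mathcal{G}(n,\bm p;m,\bm q)$: two random graphs $G_1,G_2$ on a common vertex set consisting of $n$ user vertices $\mathcal V_{\mathrm u}=[n]$ and $m$ attribute vertices $\mathcal V_{\mathrm a}$ (disjoint from $\mathcal V_{\mathrm u}$). Let $\mathcal E_{\mathrm u}$ be the set of (unordered) pairs of distinct users and $\mathcal E_{\mathrm a}=\mathcal V_{\mathrm u}\times\mathcal V_{\mathrm a}$; there are no edges between attribute vertices. $G_k(e)\in\{0,1\}$ indicates whether $e$ is an edge of $G_k$. Independently over $e\in\mathcal E_{\mathrm u}\cup\mathcal E_{\mathrm a}$, $\mathsf P((G_1(e),G_2(e))=(a,b))=p_{ab}$ for $e\in\mathcal E_{\mathrm u}$ and $=q_{ab}$ for $e\in\mathcal E_{\mathrm a}$ ($a,b\in\{0,1\}$), where $\bm p=(p_{11},p_{10},p_{01},p_{00})$ and $\bm q=(q_{11},q_{10},q_{01},q_{00})$ are probability vectors. Standing assumption: $G_1(e)$ and $G_2(e)$ are positively correlated for every $e$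 (correlation coefficient defined and $>0$). Anonymization: $\Pi^*$ is uniform on the set $\mathcal S_n$ of permutations of $[n]$, independent of $(G_1,G_2)$, and $G_2'$ is obtained from $G_2$ by relabeling each user $i$ as $\Pi^*(i)$ (attribute vertices keep their labels). An estimator is a function $\hat\pi(G_1,G_2')\in\mathcal S_n$. *)

(* Defs.v *)
From HB Require Import structures.
From mathcomp Require Import all_boot all_order all_algebra all_fingroup.
From mathcomp Require Import all_classical all_reals all_analysis.

Set Implicit Arguments.
Unset Strict Implicit.
Unset Printing Implicit Defensive.

Import Order.TTheory GRing.Theory Num.Theory.

Local Open Scope ring_scope.

Section FiniteProbability.
Variables (R : realType) (T : finType) (mu : T -> R).

Definition Pr (A : pred T) : R := \sum_(w | A w) mu w.

Definition Ex (X : T -> R) : R := \sum_w mu w * X w.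

Definition Cov (X Y : T -> R) : R :=
  Ex (fun w => (X w - Ex X) * (Y w - Ex Y)).

Definition Var (X : T -> R) : R := Cov X X.

Definition corr (X Y : T -> R) : R := Cov X Y / Num.sqrt (Var X * Var Y).

(* The conditions on the variances say that the coefficient is defined. *)
Definition positively_correlated (X Y : T -> R) : Prop :=
  [/\ 0 < Var X, 0 < Var Y & 0 < corr X Y].

End FiniteProbability.

(* A vector (p11, p10, p01, p00) is a function of two bits: p true false is
   p10, and so on. *)
Definition is_prob_vector (R : realType) (p : bool -> bool -> R) : Prop :=
  (forall a b, 0 <= p a b) /\ \sum_(a : bool) \sum_(b : bool) p a b = 1.

Definition user_edge (n : nat) : finType := {e : {set 'I_n} | #|e| == 2}.

Definition edge (n m : nat) : finType := (user_edge n + 'I_n * 'I_m)%type.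

(* The value at an edge slot e is the indicator G(e). *)
Definition graph (n m : nat) : finType := {ffun edge n m -> bool}.

Lemma card_user_edge_imset (n : nat) (s : 'S_n) (e : user_edge n) :
  #|s @: val e| == 2.
Proof. by rewrite card_imset ?(valP e) //; exact: perm_inj. Qed.

Definition user_edge_perm (n : nat) (s : 'S_n) (e : user_edge n) :
  user_edge n := exist _ (s @: val e) (card_user_edge_imset s e).

Definition edge_perm (n m : nat) (s : 'S_n) (e : edge n m) : edge n m :=
  match e with
  | inl u => inl (user_edge_perm s u)
  | inr (i, a) => inr (s i, a)
  end.

(* Renaming every user i of G as s i; see relabelE. *)
Definition relabel (n m : nat) (s : 'S_n) (G : graph n m) : graph n m :=
  [ffun e : edge n m => G (edge_perm s^-1%g e)].

Lemma edge_permK (n m : nat) (s : 'S_n) :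
  cancel (@edge_perm n m s) (edge_perm s^-1%g).
Proof.
case=> [u|[i a]] /=; last by rewrite permK.
congr inl; apply: val_inj => /=.
rewrite -imset_comp -[RHS]imset_id; apply: eq_imset => x /=.
by rewrite permK.
Qed.

Lemma relabelE (n m : nat) (s : 'S_n) (G : graph n m) (e : edge n m) :
  relabel s G (edge_perm s e) = G e.
Proof. by rewrite ffunE edge_permK. Qed.

Section Model.
Variables (R : realType) (n m : nat) (p q : bool -> bool -> R).

Definition edge_law (e : edge n m) : bool -> bool -> R :=
  match e with inl _ => p | inr _ => q end.

(* Outcomes ((G1, G2), Pi). *)
Definition outcome : finType := (graph n m * graph n m * 'S_n)%type.

Definition model_law (w : outcome) : R :=
  (\prod_(e : edge n m) edge_law e (w.1.1 e) (w.1.2 e)) * (#|{: 'S_n}|%:R)^-1.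

Definition positively_correlated_pair : Prop :=
  forall e : edge n m,
    positively_correlated model_law
      (fun w => (w.1.1 e)%:R) (fun w => (w.1.2 e)%:R).

Definition error_prob (est : graph n m -> graph n m -> 'S_n) : R :=
  Pr model_law (fun w => est w.1.1 (relabel w.2 w.1.2) != w.2).

End Model.

(* Main.v *)
(* Let G be the intersection of G1 and G2, an attributed graph with independent
   edges of probabilities p11 and q11. If exchanging two users i and j leaves G
   invariant, then, by positive correlation, replacing G2 by its image under the
   transposition and correcting Pi accordingly gives the same observation with
   at least the same likelihood. So every estimator errs with probability at
   least P(G has such twins) / 2.

   The expected number of ordered pairs of twins is n(n-1) alpha, where
   alpha = a^(n-2) b^m, a = 1 - 2 p11 + 2 p11^2 and b = 1 - 2 q11 + 2 q11^2.
   Disjoint pairs contribute at most 16 alpha^2 each to the second moment (as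
   a >= 1/2); pairs with one common user contribute at most beta each, where
   beta^2 <= 8 alpha^3 because 1 - 3s <= (1 - 2s)^(3/2). As soon as
   n^2 a^n b^m >= 1, the second moment is therefore at most 43 times the
   square of the mean, and twins exist with probability at least 1/43. *)
Require Import Defs.
From HB Require Import structures.
From mathcomp Require Import all_boot all_order all_algebra all_fingroup.
From mathcomp Require Import all_classical all_reals all_analysis.
From mathcomp Require Import ring lra.
Import Order.TTheory GRing.Theory Num.Theory.
Import numFieldNormedType.Exports.

Set Implicit Arguments.
Unset Strict Implicit.
Unset Printing Implicit Defensive.

Local Open Scope ring_scope.

(** * Expectation on a finite space and the second moment method *)

Section FiniteExpectation.
Variables (R : realType) (T : finType) (mu : T -> R).
Implicit Types (X Y : T -> R) (A B : pred T).

Lemma eq_Ex X Y : X =1 Y -> Ex mu X = Ex mu Y.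
Proof. by move=> XY; apply: eq_bigr => t _; rewrite XY. Qed.

Lemma ExD X Y : Ex mu (fun t => X t + Y t) = Ex mu X + Ex mu Y.
Proof. by rewrite -big_split; apply: eq_bigr => t _; rewrite mulrDr. Qed.

Lemma ExZ (a : R) X : Ex mu (fun t => a * X t) = a * Ex mu X.
Proof. by rewrite big_distrr; apply: eq_bigr => t _; rewrite /= mulrCA. Qed.

Lemma Ex_sum (I : finType) (P : pred I) (X : I -> T -> R) :
  Ex mu (fun t => \sum_(i | P i) X i t) = \sum_(i | P i) Ex mu (X i).
Proof. by rewrite exchange_big; apply: eq_bigr => t _; rewrite big_distrr. Qed.

Lemma PrE A : Pr mu A = Ex mu (fun t => (A t)%:R).
Proof.
by rewrite /Pr big_mkcond; apply: eq_bigr => t _; case: (A t); rewrite ?mulr1 ?mulr0.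
Qed.

Hypothesis mu_ge0 : forall t, 0 <= mu t.

Lemma le_Ex X Y : (forall t, X t <= Y t) -> Ex mu X <= Ex mu Y.
Proof. by move=> XY; apply: ler_sum => t _; rewrite ler_wpM2l. Qed.

Lemma le_Pr A B : (forall t, A t -> B t) -> Pr mu A <= Pr mu B.
Proof.
move=> AB; rewrite !PrE; apply: le_Ex => t; rewrite ler_nat.
by case: (A t) (AB t) => // ->.
Qed.

Lemma Pr_ge0 A : 0 <= Pr mu A.
Proof. by apply: sumr_ge0. Qed.

(** With [a] the mean, completing a square gives pointwise 2X <= C a 1[X != 0] + X^2 / (C a). In
    expectation the last term is at most [a], which leaves a <= C a P. *)
Lemma second_moment (X : T -> R) (C : R) :
  0 < Ex mu X -> Ex mu (fun t => X t ^+ 2) <= C * Ex mu X ^+ 2 ->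
  C^-1 <= Pr mu (fun t => X t != 0).
Proof.
move=> EX0 EX2; set a := Ex mu X in EX0 EX2 *; set P := Pr _ _.
have P0 : 0 <= P by apply: Pr_ge0.
(* For C <= 0 the bound is trivial, as [C^-1] is then nonpositive (with 0^-1 = 0). *)
have [C0|C0] := leP C 0; first by rewrite (le_trans _ P0)// invr_le0.
have main : 2 * a <= C * a * P + (C * a)^-1 * Ex mu (fun t => X t ^+ 2).
  rewrite /P PrE {1}/a -(ExZ 2) -(ExZ (C * a)) -(ExZ (C * a)^-1) -ExD.
  apply: le_Ex => t.
  have Ca : 0 < C * a by rewrite mulr_gt0.
  have [->|_] := eqVneq (X t) 0; first by rewrite !mulr0 expr0n/= mulr0 addr0.
  rewrite /= mulr1 -subr_ge0.
  have -> : C * a + (C * a)^-1 * X t ^+ 2 - 2 * X t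
      = (C * a)^-1 * (C * a - X t) ^+ 2 by field; rewrite !gt_eqF.
  by rewrite mulr_ge0 ?sqr_ge0 ?invr_ge0 ?ltW.
have : (C * a)^-1 * Ex mu (fun t => X t ^+ 2) <= a.
  by rewrite mulrC ler_pdivrMr ?mulr_gt0// (le_trans EX2)// expr2 mulrCA.
move=> /(lerD (lexx (C * a * P))) /(le_trans main); rewrite mulrDl mul1r lerD2r.
by rewrite mulrAC -{1}[a]mul1r ler_pM2r// mulrC -ler_pdivrMr ?div1r.
Qed.

End FiniteExpectation.

(** * Product laws and independence of disjoint blocks of coordinates *)

Section ProductLaw.
Variables (R : realType) (E X : finType) (w : E -> X -> R).
Hypothesis w1 : forall e, \sum_x w e x = 1.

Definition product_law (g : {ffun E -> X}) : R := \prod_e w e (g e).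

Local Notation EE := (Ex product_law).

Definition determined_on (A : {set E}) (f : {ffun E -> X} -> R) : Prop :=
  forall g h : {ffun E -> X}, {in A, g =1 h} -> f g = f h.

Lemma Ex_prod (phi : E -> X -> R) :
  EE (fun g => \prod_e phi e (g e)) = \prod_e \sum_x w e x * phi e x.
Proof. by rewrite bigA_distr_bigA; apply: eq_bigr => g _; rewrite -big_split. Qed.

Lemma Ex_cst (a : R) : EE (fun=> a) = a.
Proof.
have h : EE (fun=> 1) = 1.
  transitivity (EE (fun g => \prod_(e : E) 1)).
    by apply: eq_Ex => g; rewrite big1.
  rewrite (Ex_prod (fun _ _ => 1)) big1// => e _; rewrite -[RHS](w1 e).
  by apply: eq_bigr => x _; rewrite mulr1.
by rewrite -[RHS]mulr1 -h -ExZ; apply: eq_Ex => g; rewrite mulr1.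
Qed.

Lemma Ex_coord (e0 : E) (phi : X -> R) :
  EE (fun g => phi (g e0)) = \sum_x w e0 x * phi x.
Proof.
have := Ex_prod (fun e x => if e == e0 then phi x else 1).
rewrite [RHS](bigD1 e0)//= eqxx [X in _ * X]big1 ?mulr1 => [<-|e /negbTE ->].
  apply: eq_Ex => g; rewrite (bigD1 e0)//= eqxx big1 ?mulr1// => e.
  by move=> /negbTE ->.
by under eq_bigr do rewrite mulr1; exact: w1.
Qed.

(* Two independent copies: exchanging their coordinates outside A preserves the
   joint law and turns f(g) h(g') into f(g) h(g). *)
Lemma Ex_mul (A : {set E}) f h :
  determined_on A f -> determined_on (~: A) h ->
  EE (fun g => f g * h g) = EE f * EE h.
Proof.
move=> fA hA.
pose mix (g g' : {ffun E -> X}) : {ffun E -> X} :=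
  [ffun e => if e \in A then g e else g' e].
pose sw (u : {ffun E -> X} * {ffun E -> X}) := (mix u.1 u.2, mix u.2 u.1).
have swK : involutive sw.
  by case=> g g'; congr pair; apply/ffunP => e; rewrite !ffunE/=; case: (e \in A).
(* The factor 1 is the total mass of the second copy [g']. *)
rewrite -[LHS]mulr1 -(Ex_cst 1) /Ex !big_distrlr !pair_big/=.
rewrite [LHS](reindex_inj (inv_inj swK))/=; apply: eq_bigr => -[g g'] _ /=.
rewrite mulr1 (fA _ g) => [|e eA]; last by rewrite ffunE eA.
rewrite (hA _ g') => [|e]; last by rewrite inE ffunE => /negbTE ->.
rewrite [RHS]mulrACA [LHS]mulrAC; congr (_ * _).
rewrite /product_law -!big_split/=; apply: eq_bigr => e _.
by rewrite !ffunE; case: ifP => // _; rewrite mulrC.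
Qed.

(** Induction on a list of blocks: by disjointness the remaining product is determined off [A k], so
    [Ex_mul] splits off the factor [f k]. *)
Lemma Ex_prod_blocks (K : finType) (P : pred K) (A : K -> {set E})
    (f : K -> {ffun E -> X} -> R) :
  (forall k, P k -> determined_on (A k) (f k)) ->
  (forall k l, P k -> P l -> k != l -> [disjoint A k & A l]) ->
  EE (fun g => \prod_(k | P k) f k g) = \prod_(k | P k) EE (f k).
Proof.
move=> fA dA.
suff gen (s : seq K) : uniq s -> all P s ->
    EE (fun g => \prod_(k <- s) f k g) = \prod_(k <- s) EE (f k).
  rewrite -big_filter -gen ?filter_uniq ?index_enum_uniq ?filter_all//.
  by apply: eq_Ex => g; rewrite big_filter.
elim: s => [_ _|k s IH /= /andP[ks us] /andP[Pk Ps]].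
  by rewrite big_nil -[RHS](Ex_cst 1); apply: eq_Ex => g; rewrite big_nil.
rewrite big_cons -IH// -(@Ex_mul (A k)); last 2 first.
- exact: fA.
- move=> g h gh; apply: eq_big_seq => l ls.
  have Pl := allP Ps _ ls.
  apply: (fA _ Pl) => e el; apply: gh; rewrite inE.
  have kl : k != l by apply: contraNneq ks => ->.
  by apply: contraL el => ek; rewrite (disjointFr (dA _ _ Pk Pl kl)).
by apply: eq_Ex => g; rewrite big_cons.
Qed.

Lemma Ex_prod_coords (s : seq E) (phi : X -> R) : uniq s ->
  EE (fun g => \prod_(e <- s) phi (g e)) = \prod_(e <- s) \sum_x w e x * phi x.
Proof.
move=> us.
transitivity (EE (fun g => \prod_(e in s) phi (g e))).
  by apply: eq_Ex => g; rewrite big_uniq.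
rewrite (@Ex_prod_blocks _ _ (fun e => [set e]%SET)).
- by rewrite big_uniq//; apply: eq_bigr => e _; rewrite Ex_coord.
- by move=> e _ g h gh; rewrite gh// inE.
- by move=> k l _ _ kl; rewrite disjoints1 inE.
Qed.

End ProductLaw.

(** * Twins as agreement of two neighbourhoods *)

Section Twins.
Variables (n m : nat).
Implicit Types (G : graph n m) (S : {set 'I_n}) (v : 'I_n + 'I_m).

(** The case i = j holds trivially, so later uses carry the side condition i != j. *)
Definition twins (i j : 'I_n) G : bool := relabel (tperm i j) G == G.

Lemma twinsC i j : twins i j =1 twins j i.
Proof. by move=> G; rewrite /twins tpermC. Qed.

(* The pair {u, v}; the junk value e0 is taken when u = v. *)
Definition slot (e0 : user_edge n) (u : 'I_n) v : edge n m :=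
  match v with
  | inl x => inl (insubd e0 [set u; x]%SET)
  | inr a => inr (u, a)
  end.

Definition away S v : bool := if v is inl x then x \notin S else true.

Variable e0 : user_edge n.
Local Notation sl := (slot e0).

Lemma val_slot (u x : 'I_n) : u != x -> val (insubd e0 [set u; x]%SET) = [set u; x]%SET.
Proof. by move=> ux; rewrite insubdK// unfold_in cards2 ux. Qed.

Lemma slotC (u x : 'I_n) : sl u (inl x) = sl x (inl u).
Proof. by rewrite /slot finset.setUC. Qed.

(** One end lies in [S] and the other does not, so the two ends can be told apart although user
    edges are unordered. *)
Lemma slot_inj S u u' v v' : u \in S -> u' \in S -> away S v -> away S v' ->
  sl u v = sl u' v' -> u = u' /\ v = v'.
Proof.
have ne x y : x \in S -> y \notin S -> x != y by move=> xS; apply: contraNneq => <-.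
case: v v' => [x|a] [x'|a'] uS u'S //= vS v'S; last by case=> -> ->.
case=> /(congr1 val); rewrite !val_slot ?ne// => /setP eqs.
have := eqs x; rewrite !inE eqxx orbT => /esym/orP[/eqP xu|/eqP ->].
  by rewrite xu u'S in vS.
have := eqs u; rewrite !inE eqxx => /esym/orP[/eqP ->|/eqP ux] //.
by rewrite -ux uS in v'S.
Qed.

Lemma edge_perm_slot (s : 'S_n) (u x : 'I_n) : u != x ->
  edge_perm s (sl u (inl x)) = sl (s u) (inl (s x)).
Proof.
move=> ux; congr inl; apply: val_inj => /=.
by rewrite !val_slot ?(inj_eq perm_inj)// imsetU1 imset_set1.
Qed.

(** The transposition fixes each slot that contains none or both of i and j, and exchanges [sl i v]
    with [sl j v] for every other vertex v. *)
Lemma twinsP (i j : 'I_n) G : i != j ->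
  reflect (forall v, away [set i; j] v -> G (sl i v) = G (sl j v)) (twins i j G).
Proof.
move=> ij; apply: (iffP eqP) => [eqG v|eqG].
  move=> av; rewrite -[in RHS]eqG.
  suff -> : sl j v = edge_perm (tperm i j) (sl i v) by rewrite relabelE.
  case: v av => [x|a]; last by rewrite /= tpermL.
  rewrite [away _ _]/= !inE negb_or => /andP[xi xj].
  by rewrite edge_perm_slot 1?eq_sym// tpermL tpermD// eq_sym.
have adj (u v : 'I_n) : v != i -> v != j -> u = i \/ u = j ->
    G (sl (tperm i j u) (inl v)) = G (sl u (inl v)).
  move=> vi vj; have av : away [set i; j] (inl v) by rewrite /= !inE negb_or vi.
  by case=> ->; rewrite ?tpermL ?tpermR eqG.
apply/ffunP => e; rewrite ffunE tpermV.
case: e => [e|[u a]] /=; last first.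
  have := eqG (inr a) isT; rewrite /slot => eqGa.
  by case: tpermP => // ->.
have /cards2P[u [x [ux ex]]] := valP e.
have -> : e = insubd e0 [set u; x]%SET by apply: val_inj; rewrite val_slot.
have := edge_perm_slot (tperm i j) ux; rewrite /slot /= => ->.
rewrite -/(sl u (inl x)) -/(sl _ (inl _)).
have [uij|uij] := boolP (u \in [set i; j]%SET);
  have [xij|xij] := boolP (x \in [set i; j]%SET).
- suff -> : sl (tperm i j u) (inl (tperm i j x)) = sl u (inl x) by [].
  move: uij xij ux; rewrite !inE.
  by do 2 case/orP => /eqP ->; rewrite ?eqxx// tpermL tpermR slotC.
- move: uij xij; rewrite !inE negb_or => /pred2P uij /andP[xi xj].
  by rewrite (tpermD (z := x)) 1?eq_sym// adj.
- move: uij xij; rewrite !inE negb_or => /andP[ui uj] /pred2P xij.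
  by rewrite (tpermD (z := u)) 1?eq_sym// slotC adj// slotC.
- move: uij xij; rewrite !inE !negb_or => /andP[ui uj] /andP[xi xj].
  by rewrite !tpermD// eq_sym.
Qed.

End Twins.

Arguments slot : simpl never.

(** * Probabilities of one and of two twin events under a product law *)

Section TwinMoments.
Variables (R : realType) (n m : nat) (X : finType).
Variables (w : edge n m -> X -> R) (bit : pred X) (p q : R).
Hypothesis w_ge0 : forall e x, 0 <= w e x.
Hypothesis w1 : forall e, \sum_x w e x = 1.
Hypothesis w_bit : forall e,
  \sum_x w e x * (bit x)%:R = if e is inl _ then p else q.

Local Notation EE := (Ex (product_law w)).

(** The alphabet [X] stays abstract here. Later it consists of pairs of bits and [bit] is their
    conjunction, so that [bits] gives the intersection graph. *)
Definition bits (g : {ffun edge n m -> X}) : graph n m := [ffun e => bit (g e)].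

Lemma product_law_ge0 g : 0 <= product_law w g.
Proof. exact: prodr_ge0. Qed.

(* The probability that k independent Bernoulli(r) bits coincide. *)
Definition coincidence (k : nat) (r : R) : R := r ^+ k + (1 - r) ^+ k.

Lemma Ex_coincide (s : seq (edge n m)) (r : R) : uniq s ->
  (forall e, e \in s -> \sum_x w e x * (bit x)%:R = r) ->
  EE (fun g => \prod_(e <- s) (bits g e)%:R + \prod_(e <- s) (~~ bits g e)%:R)
  = coincidence (size s) r.
Proof.
move=> us rs; rewrite ExD; congr (_ + _).
  transitivity (EE (fun g => \prod_(e <- s) (bit (g e))%:R)).
    by apply: eq_Ex => g; apply: eq_bigr => e _; rewrite ffunE.
  rewrite (Ex_prod_coords w1 (fun x => (bit x)%:R))//.
  by rewrite (eq_big_seq _ rs) big_const_seq count_predT -Monoid.iteropE.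
transitivity (EE (fun g => \prod_(e <- s) (~~ bit (g e))%:R)).
  by apply: eq_Ex => g; apply: eq_bigr => e _; rewrite ffunE.
rewrite (Ex_prod_coords w1 (fun x => (~~ bit x)%:R))//.
transitivity (\prod_(e <- s) (1 - r)).
  2: by rewrite big_const_seq count_predT -Monoid.iteropE.
apply: eq_big_seq => e /rs <-.
rewrite -[X in _ = X - _](w1 e) -sumrB; apply: eq_bigr => x _.
by case: (bit x); rewrite ?mulr0 ?mulr1 ?subrr ?subr0.
Qed.

Lemma Ex_coincide2 (e1 e2 : edge n m) (r : R) : e1 != e2 ->
  \sum_x w e1 x * (bit x)%:R = r -> \sum_x w e2 x * (bit x)%:R = r ->
  EE (fun g => (bits g e1 == bits g e2)%:R) = coincidence 2 r.
Proof.
move=> e12 r1 r2; rewrite -(@Ex_coincide [:: e1; e2])/= ?inE ?e12//; last first.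
  by move=> e; rewrite !inE => /pred2P[] ->.
apply: eq_Ex => g; rewrite !big_cons !big_nil.
by do 2 case: (bits g _); rewrite ?mulr1 ?mulr0 ?mul0r ?addr0 ?add0r.
Qed.

Lemma Ex_coincide3 (e1 e2 e3 : edge n m) (r : R) : uniq [:: e1; e2; e3] ->
  (forall e, e \in [:: e1; e2; e3] -> \sum_x w e x * (bit x)%:R = r) ->
  EE (fun g => ((bits g e1 == bits g e2) && (bits g e1 == bits g e3))%:R)
  = coincidence 3 r.
Proof.
move=> us rs; rewrite -(Ex_coincide us rs).
apply: eq_Ex => g; rewrite !big_cons !big_nil.
by do 3 case: (bits g _); rewrite ?mulr1 ?mulr0 ?mul0r ?addr0 ?add0r.
Qed.

Variable e0 : user_edge n.
Local Notation sl := (slot e0).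

Section Rows.
Variables (S : {set 'I_n}) (phi : ('I_n -> bool) -> bool).
Hypothesis phiS : forall x y, {in S, x =1 y} -> phi x = phi y.

Local Notation row g v := (phi (fun u => bits g (sl u v))).

(** By [phiS] the row of v depends only on the slots joining v to [S]. These blocks are disjoint for
    distinct v, so the rows are independent: n - |S| user rows and m attribute rows. *)
Lemma Ex_rows (ap aq : R) :
  (forall x, x \notin S -> EE (fun g => (row g (inl x))%:R) = ap) ->
  (forall a, EE (fun g => (row g (inr a))%:R) = aq) ->
  EE (fun g => [forall v, away S v ==> row g v]%:R)
  = ap ^+ (n - #|S|) * aq ^+ m.
Proof.
move=> hp hq.
transitivity (EE (fun g => \prod_(v | away S v) (row g v)%:R)).
  apply: eq_Ex => g; case: forallP => [h|/forallP].
    by rewrite big1// => v av; move: (h v); rewrite av => /= ->.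
  rewrite negb_forall => /existsP[v]; rewrite negb_imply => /andP[av /negbTE rv].
  by rewrite (bigD1 v)//= rv mul0r.
rewrite (@Ex_prod_blocks _ _ _ _ w1 _ _ (fun v => [set sl u v | u in S]%SET)).
- rewrite big_sumType/=; congr (_ * _).
    rewrite (eq_bigr (fun=> ap)) ?prodr_const; last by move=> x; exact: hp.
    have -> : (n - #|S| = #|~: S|)%N by apply/(canLR (addKn _)); rewrite cardsC card_ord.
    by congr (_ ^+ _); apply: eq_card => x; rewrite !inE.
  by rewrite (eq_bigr (fun=> aq)) => [|a _]; rewrite ?hq// prodr_const card_ord.
- move=> v _ g h gh; congr (nat_of_bool _)%:R; apply: phiS => u uS.
  by rewrite !ffunE gh//=; apply: imset_f.
- move=> v v' av av' vv'; rewrite -setI_eq0; apply/eqP/setP => e; rewrite !inE.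
  apply/negP => /andP[/imsetP[u uS ->] /imsetP[u' u'S]].
  by case/(slot_inj uS u'S av av') => _ /eqP; rewrite (negbTE vv').
Qed.

End Rows.

Lemma slot_neq (S : {set 'I_n}) u u' (v : 'I_n + 'I_m) : u \in S -> u' \in S -> away S v ->
  u != u' -> sl u v != sl u' v.
Proof. by move=> uS u'S av; apply: contra_neq => /(slot_inj uS u'S av av)[]. Qed.

Lemma w_bit_user u x : \sum_y w (sl u (inl x)) y * (bit y)%:R = p.
Proof. exact: w_bit. Qed.

Lemma w_bit_attr u a : \sum_y w (sl u (inr a)) y * (bit y)%:R = q.
Proof. exact: w_bit. Qed.

Lemma Ex_twins (i j : 'I_n) : i != j ->
  EE (fun g => (twins i j (bits g))%:R)
  = coincidence 2 p ^+ (n - 2) * coincidence 2 q ^+ m.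
Proof.
move=> ij; have -> : (n - 2 = n - #|[set i; j]%SET|)%N by rewrite cards2 ij.
rewrite -(@Ex_rows [set i; j]%SET (fun x => x i == x j)).
- apply: eq_Ex => g; congr (nat_of_bool _)%:R.
  apply/(twinsP e0 _ ij)/forallP => [h v|h v av].
    by apply/implyP => /h ->.
  by apply/eqP; move: (h v); rewrite av.
- by move=> x y xy; rewrite !xy ?inE ?eqxx ?orbT.
- move=> x xS; rewrite (@Ex_coincide2 _ _ p) ?w_bit_user//.
  by apply: (@slot_neq [set i; j]%SET) => //; rewrite !inE eqxx ?orbT.
- move=> a; rewrite (@Ex_coincide2 _ _ q) ?w_bit_attr//.
  by apply: (@slot_neq [set i; j]%SET) => //; rewrite !inE eqxx ?orbT.
Qed.

(** Constraints on slots inside {i, j, k} are dropped, whence the inequality. Every other vertex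
    requires its three bits towards i, j and k to coincide. *)
Lemma Ex_twins_shared (i j k : 'I_n) : uniq [:: i; j; k] ->
  EE (fun g => (twins i j (bits g) && twins i k (bits g))%:R)
  <= coincidence 3 p ^+ (n - 3) * coincidence 3 q ^+ m.
Proof.
move=> us; pose S := [set x in [:: i; j; k]]%SET.
have [iS jS kS] : [/\ i \in S, j \in S & k \in S] by rewrite !inE !eqxx !orbT.
have -> : (n - 3 = n - #|S|)%N by rewrite cardsE (card_uniqP us).
move: us; rewrite /= !inE !negb_or -!andbA => /and4P[ij ik jk _].
rewrite -(@Ex_rows S (fun x => (x i == x j) && (x i == x k))).
- apply: le_Ex => [|g]; first exact: product_law_ge0.
  rewrite ler_nat; case: andP => // -[/(twinsP e0 _ ij) hj /(twinsP e0 _ ik) hk].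
  rewrite lt0b; apply/forallP => v; apply/implyP => av.
  apply/andP; split; apply/eqP; [apply: hj|apply: hk]; case: v av => //= x;
    by rewrite !inE; apply: contra => /orP[] ->; rewrite ?orbT.
- by move=> x y xy; rewrite !xy.
- move=> x xS; rewrite (@Ex_coincide3 _ _ _ p)//=.
    by rewrite !inE negb_or !(@slot_neq S).
  by move=> e; rewrite !inE => /or3P[]/eqP ->; exact: w_bit.
- move=> a; rewrite (@Ex_coincide3 _ _ _ q)//=.
    by rewrite !inE negb_or !(@slot_neq S).
  by move=> e; rewrite !inE => /or3P[]/eqP ->; exact: w_bit.
Qed.

(** Again the slots inside the four users are dropped. Every other vertex contributes two
    independent coincidences, one for each pair. *)
Lemma Ex_twins_disjoint (i j k l : 'I_n) : uniq [:: i; j; k; l] ->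
  EE (fun g => (twins i j (bits g) && twins k l (bits g))%:R)
  <= (coincidence 2 p ^+ 2) ^+ (n - 4) * (coincidence 2 q ^+ 2) ^+ m.
Proof.
move=> us; pose S := [set x in [:: i; j; k; l]]%SET.
have [iS jS kS lS] : [/\ i \in S, j \in S, k \in S & l \in S].
  by rewrite !inE !eqxx !orbT.
have -> : (n - 4 = n - #|S|)%N by rewrite cardsE (card_uniqP us).
move: us; rewrite /= !inE !negb_or -!andbA => /and5P[ij ik il jk] /and3P[jl kl _].
have row2 v r : away S v -> (forall u, \sum_x w (sl u v) x * (bit x)%:R = r) ->
    EE (fun g => ((bits g (sl i v) == bits g (sl j v))
                  && (bits g (sl k v) == bits g (sl l v)))%:R)
    = coincidence 2 r ^+ 2.
  move=> av rv; have neq := slot_neq _ _ av.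
  transitivity (EE (fun g => (bits g (sl i v) == bits g (sl j v))%:R
                      * (bits g (sl k v) == bits g (sl l v))%:R)).
    by apply: eq_Ex => g; rewrite -natrM mulnb.
  rewrite (@Ex_mul _ _ _ _ w1 [set sl i v; sl j v]%SET).
  - by rewrite !(@Ex_coincide2 _ _ r) ?neq.
  - by move=> g h gh; rewrite !ffunE !gh ?inE ?eqxx ?orbT.
  - by move=> g h gh; rewrite !ffunE !gh ?inE ?negb_or ?neq// eq_sym.
rewrite -(@Ex_rows S (fun x => (x i == x j) && (x k == x l))).
- apply: le_Ex => [|g]; first exact: product_law_ge0.
  rewrite ler_nat; case: andP => // -[/(twinsP e0 _ ij) hj /(twinsP e0 _ kl) hk].
  rewrite lt0b; apply/forallP => v; apply/implyP => av.
  apply/andP; split; apply/eqP; [apply: hj|apply: hk]; case: v av => //= x;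
    by rewrite !inE; apply: contra => /orP[] ->; rewrite ?orbT.
- by move=> x y xy; rewrite !xy.
- by move=> x xS; apply: row2 => // u; exact: w_bit.
- by move=> a; apply: row2 => // u; exact: w_bit.
Qed.

End TwinMoments.

(* An estimator only sees obs. If every outcome of B can be exchanged, without
   changing obs or decreasing its mass, for one with another key, then on each
   fibre of obs at most half of the mass of B is guessed correctly. *)
Lemma Pr_confusable (R : realType) (T O U : finType) (mu : T -> R)
    (obs : T -> O) (key : T -> U) (est : O -> U) (B : pred T) (h : T -> T) :
  (forall t, 0 <= mu t) ->
  (forall s t, obs s = obs t -> key s = key t -> s = t) ->
  (forall t, B t -> [/\ obs (h t) = obs t, key (h t) != key t & mu t <= mu (h t)]) ->
  Pr mu B <= 2 * Pr mu (fun t => est (obs t) != key t).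
Proof.
move=> mu0 inj hB; pose C := [set t | B t & est (obs t) == key t]%SET.
rewrite /Pr (bigID (fun t => est (obs t) != key t))/= -/(Pr _ _) mulr2n mulrDl !mul1r.
apply: lerD; first by apply: le_Pr => // t; case/andP.
rewrite (eq_bigl (fun t => t \in C)) => [|t]; last by rewrite /= inE negbK.
apply: (@le_trans _ _ (\sum_(t in C) mu (h t))).
  by apply: ler_sum => t; rewrite inE => /andP[Bt _]; have [] := hB t Bt.
(* [h] is injective on [C]: equal images force equal observations, hence equal guesses, and on [C]
   the guess is the key. *)
rewrite -(@big_imset _ _ _ _ _ h)/=; last first.
  move=> s t; rewrite !inE => /andP[/hB[os _ _] /eqP es] /andP[/hB[ot _ _] /eqP et] hst.
  by have ost : obs s = obs t; [rewrite -os hst|apply: inj; rewrite -?es -?et ?ost].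
apply: le_Pr => // _ /imsetP[t /[!inE] /andP[/hB[ot kt _] /eqP et] ->].
by rewrite ot et eq_sym.
Qed.

(** * The model law and the reduction of the error probability to twins *)

Section Model.
Variables (R : realType) (n m : nat) (p q : bool -> bool -> R).
Hypotheses (hp : is_prob_vector p) (hq : is_prob_vector q).

Local Notation law := (@edge_law R n m p q).
Local Notation mu := (@model_law R n m p q).

Definition slot_law (e : edge n m) (x : bool * bool) : R := law e x.1 x.2.

Definition zip_graphs (G1 G2 : graph n m) : {ffun edge n m -> bool * bool} :=
  [ffun e => (G1 e, G2 e)].

Lemma edge_law_ge0 e a b : 0 <= law e a b.
Proof. by case: e => ?; [exact: hp.1|exact: hq.1]. Qed.

Lemma sum_slot_law e : \sum_x slot_law e x = 1.
Proof.
rewrite -(pair_bigA _ (fun a b => law e a b))/=.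
by case: e => ?; [exact: hp.2|exact: hq.2].
Qed.

Lemma model_law_ge0 o : 0 <= mu o.
Proof.
by rewrite mulr_ge0 ?invr_ge0 ?ler0n ?prodr_ge0// => e _; exact: edge_law_ge0.
Qed.

(** The uniform permutation sums out, and a pair of graphs is the same as one configuration of pairs
    of bits. *)
Lemma Ex_model (F : {ffun edge n m -> bool * bool} -> R) :
  Ex mu (fun o => F (zip_graphs o.1.1 o.1.2)) = Ex (product_law slot_law) F.
Proof.
have N0 : (#|{: 'S_n}|%:R : R) != 0.
  by rewrite pnatr_eq0 -lt0n; apply/card_gt0P; exists 1%g.
transitivity (\sum_(G : graph n m * graph n m)
    product_law slot_law (zip_graphs G.1 G.2) * F (zip_graphs G.1 G.2)).
  rewrite /Ex -(pair_bigA _ (fun (G : graph n m * graph n m) (s : 'S_n) =>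
    mu (G, s) * F (zip_graphs G.1 G.2)))/=.
  apply: eq_bigr => -[G1 G2] _; rewrite /model_law/= sumr_const -[LHS]mulr_natr.
  rewrite mulrAC divfK//.
  by congr (_ * _); apply: eq_bigr => e _; rewrite ffunE.
rewrite [RHS](reindex (fun G : graph n m * graph n m => zip_graphs G.1 G.2))//=.
exists (fun g : {ffun edge n m -> bool * bool} =>
    ([ffun e => (g e).1], [ffun e => (g e).2])) => [[G1 G2]|g] _.
  by congr pair; apply/ffunP => e; rewrite !ffunE.
by apply/ffunP => e; rewrite !ffunE; case: (g e).
Qed.

Lemma Ex_model_slot (e : edge n m) (phi : bool * bool -> R) :
  Ex mu (fun o => phi (o.1.1 e, o.1.2 e)) =
  \sum_(a : bool) \sum_(b : bool) law e a b * phi (a, b).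
Proof.
transitivity (Ex mu (fun o => phi (zip_graphs o.1.1 o.1.2 e))).
  by apply: eq_Ex => o; rewrite ffunE.
rewrite (Ex_model (fun g => phi (g e))) (Ex_coord sum_slot_law) pair_bigA.
by apply: eq_bigr => -[].
Qed.

(** As the masses at a slot sum to 1, the covariance of the two bits equals p11 p00 - p10 p01. *)
Lemma positive_correlation_law : @positively_correlated_pair R n m p q ->
  forall e, law e true false * law e false true <= law e true true * law e false false.
Proof.
move=> hc e; have [_ _] := hc e; rewrite /corr /Cov.
have := sum_slot_law e; rewrite -(pair_bigA _ (fun a b => law e a b)) !big_bool /=.
move=> s1.
rewrite (Ex_model_slot e (fun x => x.1%:R)) (Ex_model_slot e (fun x => x.2%:R)).
set x := \sum_(a : bool) _; set y := \sum_(a : bool) _.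
rewrite (Ex_model_slot e (fun z => (z.1%:R - x) * (z.2%:R - y))).
rewrite /x /y !big_bool/= !mulr1 !mulr0 !addr0 ?add0r.
set c := (X in X / _) => cpos.
(* The correlation divides the covariance [c] by a nonnegative square root, so a positive quotient
   forces [c] to be positive. *)
have c0 : 0 < c.
  rewrite ltNge; apply/negP => c0; move: cpos; rewrite ltNge => /negP; apply.
  by rewrite mulr_le0_ge0// invr_ge0 sqrtr_ge0.
move: s1 c0; rewrite /c.
move: (law e _ _) (law e _ _) (law e _ _) (law e _ _) => tt tf ft ff s1 c0.
rewrite -subr_ge0 ltW//; apply: (lt_le_trans c0).
have -> : ff = 1 - tt - tf - ft by rewrite -s1; ring.
by rewrite le_eqVlt; apply/orP; left; apply/eqP; ring.
Qed.

Lemma edge_law_perm s e : law (edge_perm s e) = law e.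
Proof. by case: e => // -[]. Qed.

Hypothesis hc : forall e,
  law e true false * law e false true <= law e true true * law e false false.

(** After squaring, one of the two factors on each side is reindexed by the swap, which matches slot
    e with its image. The claim then reduces to one inequality per slot. *)
Lemma prod_edge_law_twins (i j : 'I_n) (G1 G2 : graph n m) :
  twins i j [ffun e => G1 e && G2 e] ->
  \prod_e law e (G1 e) (G2 e) <= \prod_e law e (G1 e) (relabel (tperm i j) G2 e).
Proof.
set t := tperm i j => /eqP tw.
have tE G e : relabel t G e = G (edge_perm t e) by rewrite ffunE tpermV.
have tinj : injective (@edge_perm n m t) by exact: can_inj (edge_permK t).
have tK e : edge_perm t (edge_perm t e) = e.
  by have := edge_permK t e; rewrite tpermV.
have ge0 (F : edge n m -> bool * bool) : 0 <= \prod_e law e (F e).1 (F e).2.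
  by apply: prodr_ge0 => e _; exact: edge_law_ge0.
rewrite -(@ler_pXn2r _ 2)// ?nnegrE; [|exact: (ge0 (fun e => (G1 e, G2 e)))
  |exact: (ge0 (fun e => (G1 e, relabel t G2 e)))].
rewrite !expr2 {2}(reindex_inj tinj) [X in _ <= _ * X](reindex_inj tinj) /=.
rewrite -!big_split/=; apply: ler_prod => e _.
rewrite mulr_ge0 ?edge_law_ge0//= !edge_law_perm !tE tK.
(* The intersection bits agree, so either both slots carry 11 or neither does. The two sides then
   differ only if one slot carries 10 and the other 01, and there [hc] applies. *)
have : G1 (edge_perm t e) && G2 (edge_perm t e) = G1 e && G2 e.
  by move/ffunP: tw => /(_ e); rewrite tE !ffunE.
have := hc e; case: (G1 e); case: (G2 e); case: (G1 _); case: (G2 _) => //= hce _;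
  by [|rewrite [X in _ <= X]mulrC|rewrite mulrC|rewrite mulrC [X in _ <= X]mulrC].
Qed.

Definition has_twins (G : graph n m) : bool :=
  [exists ij : 'I_n * 'I_n, (ij.1 != ij.2) && twins ij.1 ij.2 G].

Lemma error_prob_has_twins (est : graph n m -> graph n m -> 'S_n) :
  Pr mu (fun o => has_twins [ffun e => o.1.1 e && o.1.2 e]) <=
  2 * error_prob p q est.
Proof.
pose G (o : outcome n m) : graph n m := [ffun e => o.1.1 e && o.1.2 e].
(* Products of permutations act left factor first, so [t^-1 * o.2] undoes the relabeling by [t] and
   then applies [o.2]: the observed graph is unchanged. *)
pose sw (t : 'S_n) (o : outcome n m) : outcome n m :=
  (o.1.1, relabel t o.1.2, (t^-1 * o.2)%g).
pose h (o : outcome n m) :=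
  if [pick ij : 'I_n * 'I_n | (ij.1 != ij.2) && twins ij.1 ij.2 (G o)] is Some ij
  then sw (tperm ij.1 ij.2) o else o.
apply: (@Pr_confusable _ _ (graph n m * graph n m)%type _ _
  (fun o => (o.1.1, relabel o.2 o.1.2)) (fun o => o.2) (fun g => est g.1 g.2)
  _ h).
- exact: model_law_ge0.
- move=> [[G1 G2] s] [[G1' G2'] s'] /= [-> eqG] ss'; subst s'.
  congr (_, _, _); apply/ffunP => e; rewrite -(relabelE s) eqG.
  by rewrite relabelE.
move=> o /existsP[ij0 Bo]; rewrite /h.
case: pickP => [ij /andP[ne tw]|/(_ ij0)]; last by rewrite Bo.
split.
- congr pair; apply/ffunP => e; rewrite /= !ffunE; congr (o.1.2 _).
  rewrite invMg invgK; case: e => [u|[u a]] /=; last by rewrite permM permK.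
  congr inl; apply: val_inj; rewrite /= -imset_comp; apply: eq_imset => x /=.
  by rewrite permM permK.
- apply: contraNneq ne => /= /(congr1 (mulg^~ o.2^-1%g)); rewrite -mulgA mulgV mulg1.
  move=> /eqP; rewrite tpermV => /eqP t1.
  by rewrite -(tpermL ij.1 ij.2) t1 perm1.
- rewrite ler_pM2r ?invr_gt0 ?ltr0n; last by apply/card_gt0P; exists 1%g.
  exact: prod_edge_law_twins.
Qed.

End Model.

(** * Elementary sums and numerical inequalities for the second moment *)

Lemma sum_eq1 (R : realType) (I : finType) (a : I) :
  \sum_(x : I) (x == a)%:R = 1 :> R.
Proof. by rewrite (bigD1 a)//= eqxx big1 ?addr0// => x /negbTE ->. Qed.

Lemma le_sum_pred (R : realType) (I : finType) (A : pred I) (F : I -> R) :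
  (forall x, 0 <= F x) -> \sum_(x | A x) F x <= \sum_x F x.
Proof. by move=> F0; rewrite [leRHS](bigID A)/= lerDl sumr_ge0. Qed.

(** Here x stands for n. Disjoint, overlapping and equal pairs account for 16, 23 and 4 times the
    squared mean, in total 43. *)
Lemma second_moment_arith (R : realType) (x N alpha beta : R) :
  4 <= x -> N = x * (x - 1) -> 0 < alpha -> 0 <= beta ->
  beta ^+ 2 <= 8 * alpha ^+ 3 -> 1 <= x ^+ 2 * alpha ->
  16 * alpha ^+ 2 * N ^+ 2 + 4 * beta * N * x + 2 * alpha * N
  <= 43 * (N * alpha) ^+ 2.
Proof.
move=> x4 NE alpha_gt0 beta_ge0 beta2 big.
have x0 : 0 <= x by apply: le_trans x4.
have alpha_ge0 := ltW alpha_gt0.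
have N_ge : x ^+ 2 <= 2 * N by rewrite NE; nra.
have N_gt0 : 0 < N by rewrite NE; nra.
have same : 2 * alpha * N <= 4 * (N * alpha) ^+ 2.
  have : 1 <= 2 * (N * alpha).
    by rewrite mulrA (le_trans big)// ler_wpM2r// ltW.
  by have := mulr_gt0 N_gt0 alpha_gt0; nra.
(* Compared after squaring: the left side is at most 512 alpha^3, and 23^2 = 529 exceeds 512. *)
have beta_le : 8 * beta <= 23 * (x * alpha ^+ 2).
  rewrite -(@ler_pXn2r _ 2)// ?nnegrE ?mulr_ge0 ?sqr_ge0//.
  rewrite exprMn; apply: (@le_trans _ _ (8 ^+ 2 * (8 * alpha ^+ 3))).
    by rewrite ler_wpM2l// exprn_ge0.
  have a3 : 0 <= alpha ^+ 3 by rewrite exprn_ge0// ltW.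
  have -> : (23 * (x * alpha ^+ 2)) ^+ 2
      = 529 * (alpha ^+ 3 * (x ^+ 2 * alpha)) by ring.
  have : alpha ^+ 3 <= alpha ^+ 3 * (x ^+ 2 * alpha) by rewrite ler_peMr.
  by lra.
have shared : 4 * beta * N * x <= 23 * (N * alpha) ^+ 2.
  have -> : 4 * beta * N * x = 2^-1 * N * x * (8 * beta) by field.
  apply: (@le_trans _ _ (2^-1 * N * x * (23 * (x * alpha ^+ 2)))).
    by rewrite ler_wpM2l// !mulr_ge0// ?invr_ge0// ltW.
  have -> : 2^-1 * N * x * (23 * (x * alpha ^+ 2))
      = 23 * (2^-1 * N * alpha ^+ 2 * x ^+ 2) by ring.
  have -> : (N * alpha) ^+ 2 = 2^-1 * N * alpha ^+ 2 * (2 * N) by field.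
  have c0 : 0 <= 2^-1 * N * alpha ^+ 2.
    by rewrite !mulr_ge0 ?sqr_ge0// ?invr_ge0// ltW.
  by rewrite ler_wpM2l// ler_wpM2l.
have -> : 43 * (N * alpha) ^+ 2 =
    16 * alpha ^+ 2 * N ^+ 2 + 23 * (N * alpha) ^+ 2 + 4 * (N * alpha) ^+ 2 by ring.
by rewrite !lerD.
Qed.

Section CoincidenceBounds.
Variables (R : realType) (r : R).
Hypothesis r01 : 0 <= r <= 1.

Lemma coincidence2E : coincidence 2 r = 1 - 2 * r + 2 * r ^+ 2.
Proof. by rewrite /coincidence; ring. Qed.

Lemma coincidence2_ge : 2^-1 <= coincidence 2 r.
Proof. by rewrite coincidence2E; have := sqr_ge0 (r - 2^-1); nra. Qed.

Lemma coincidence2_le1 : coincidence 2 r <= 1.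
Proof. by rewrite coincidence2E; case/andP: r01 => r0 r1; nra. Qed.

Lemma coincidence3_ge0 : 0 <= coincidence 3 r.
Proof.
by case/andP: r01 => r0 r1; rewrite addr_ge0 ?exprn_ge0 ?subr_ge0.
Qed.

(* With s = r(1-r) <= 1/4 this is (1-3s)^2 <= (1-2s)^3. *)
Lemma coincidence3_le : coincidence 3 r ^+ 2 <= coincidence 2 r ^+ 3.
Proof.
have s4 : 0 <= 3 - 8 * (r * (1 - r)) by have := sqr_ge0 (r - 2^-1); nra.
rewrite -subr_ge0.
have -> : coincidence 2 r ^+ 3 - coincidence 3 r ^+ 2
    = (r * (1 - r)) ^+ 2 * (3 - 8 * (r * (1 - r))).
  by rewrite /coincidence; ring.
by rewrite mulr_ge0// sqr_ge0.
Qed.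

End CoincidenceBounds.

(** * First and second moments of the number of ordered twin pairs *)

Section TwinPairs.
Variables (R : realType) (n m : nat) (p q : bool -> bool -> R).
Hypotheses (hp : is_prob_vector p) (hq : is_prob_vector q).

Let P := p true true.
Let Q := q true true.
Let alpha := coincidence 2 P ^+ (n - 2) * coincidence 2 Q ^+ m.
Let beta := coincidence 3 P ^+ (n - 3) * coincidence 3 Q ^+ m.

Lemma prob_vector_tt01 (s : bool -> bool -> R) :
  is_prob_vector s -> 0 <= s true true <= 1.
Proof.
case=> s0; rewrite !big_bool/= => <-.
by rewrite s0/= -addrA lerDl !addr_ge0.
Qed.

Let P01 : 0 <= P <= 1. Proof. exact: prob_vector_tt01. Qed.
Let Q01 : 0 <= Q <= 1. Proof. exact: prob_vector_tt01. Qed.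

Let a_gt0 : 0 < coincidence 2 P.
Proof. by rewrite (lt_le_trans _ (coincidence2_ge P)). Qed.

Let b_gt0 : 0 < coincidence 2 Q.
Proof. by rewrite (lt_le_trans _ (coincidence2_ge Q)). Qed.

Let alpha_gt0 : 0 < alpha. Proof. by rewrite mulr_gt0 ?exprn_gt0. Qed.
Let beta_ge0 : 0 <= beta.
Proof. by rewrite mulr_ge0 ?exprn_ge0 ?coincidence3_ge0. Qed.

(** [coincidence3_le] is applied factorwise. The exponent n - 3 against n - 2 leaves a cube of
    [coincidence 2 P], which is at least 1/8. *)
Lemma beta_sqr_le : (2 < n)%N -> beta ^+ 2 <= 8 * alpha ^+ 3.
Proof.
move=> n2; have pow_le k r : 0 <= r <= 1 ->
    (coincidence 3 r ^+ k) ^+ 2 <= (coincidence 2 r ^+ k) ^+ 3.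
  move=> r01; rewrite 2!(exprAC _ k) lerXn2r ?nnegrE ?exprn_ge0 ?coincidence3_le//.
  - exact: coincidence3_ge0.
  - by rewrite (le_trans _ (coincidence2_ge r)).
apply: (@le_trans _ _ ((coincidence 2 P ^+ (n - 3) * coincidence 2 Q ^+ m) ^+ 3)).
  by rewrite /beta !exprMn ler_pM ?pow_le// exprn_ge0// exprn_ge0// coincidence3_ge0.
rewrite /alpha (_ : n - 2 = (n - 3).+1)%N; last by rewrite -subSn.
rewrite [_ ^+ (n - 3).+1]exprS -(mulrA (coincidence 2 P)).
rewrite [X in _ <= 8 * X]exprMn (mulrA 8).
apply: ler_peMl; first by rewrite exprn_ge0// mulr_ge0// exprn_ge0// ltW.
rewrite [leLHS](_ : 1 = 8 * 2^-1 ^+ 3); last by field.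
by rewrite ler_pM2l// lerXn2r ?nnegrE ?coincidence2_ge ?ltW// invr_gt0.
Qed.

(** The exponent n - 4 against n - 2, squared, leaves a fourth power of [coincidence 2 P], which is
    at least 1/16. *)
Lemma disjoint_le : (3 < n)%N ->
  (coincidence 2 P ^+ 2) ^+ (n - 4) * (coincidence 2 Q ^+ 2) ^+ m
  <= 16 * alpha ^+ 2.
Proof.
move=> n3; rewrite /alpha (_ : n - 2 = 2 + (n - 4))%N; last first.
  by rewrite addnBA.
rewrite exprD -(mulrA (coincidence 2 P ^+ 2)).
rewrite [X in _ <= 16 * X]exprMn (mulrA 16).
rewrite 2!(exprAC _ 2) -exprMn; apply: ler_peMl.
  by rewrite exprn_ge0// mulr_ge0// exprn_ge0// ltW.
rewrite [leLHS](_ : 1 = 16 * (2^-1 ^+ 2) ^+ 2); last by field.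
by rewrite ler_pM2l// !lerXn2r ?nnegrE ?exprn_ge0 ?coincidence2_ge ?ltW// invr_gt0.
Qed.

Local Notation w := (@slot_law R n m p q).
Local Notation EE := (Ex (product_law w)).
Local Notation bt := (fun x : bool * bool => x.1 && x.2).

Lemma slot_law_bit e :
  \sum_x w e x * (bt x)%:R = if e is inl _ then P else Q.
Proof.
rewrite -(pair_bigA _ (fun a b => w e (a, b) * (a && b)%:R)) !big_bool/=.
by rewrite !mulr0 mulr1 !addr0; case: e.
Qed.

Lemma slot_law_ge0 e x : 0 <= w e x. Proof. exact: edge_law_ge0. Qed.

Definition twin_pairs (G : graph n m) : R :=
  \sum_(ij : 'I_n * 'I_n | ij.1 != ij.2) (twins ij.1 ij.2 G)%:R.

Let N : R := \sum_(ij : 'I_n * 'I_n | ij.1 != ij.2) 1.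

Lemma NE : N = n%:R * (n%:R - 1).
Proof.
rewrite /N -(pair_big_dep xpredT (fun i j => i != j) (fun _ _ => 1 : R))/=.
rewrite (eq_bigr (fun=> n%:R - 1)) => [|i _].
  by rewrite sumr_const card_ord -[LHS]mulr_natl.
have -> : n%:R = \sum_(j < n) (1 : R) by rewrite sumr_const card_ord.
rewrite [X in X - 1](bigD1 i)//= addrAC subrr add0r.
by apply: eq_bigl => j; rewrite eq_sym.
Qed.

Hypothesis n_gt3 : (3 < n)%N.

(** Supplies the junk value that [slot] requires. *)
Lemma user_edge_witness : user_edge n.
Proof.
have n0 : (0 < n)%N by exact: leq_trans n_gt3.
have n1 : (1 < n)%N by exact: leq_trans n_gt3.
exists [set Ordinal n0; Ordinal n1]%SET.
by rewrite cards2.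
Qed.

Let e0 := user_edge_witness.
Local Notation bits' := (@bits n m (bool * bool)%type bt).

Lemma Ex_twin_pairs : EE (fun g => twin_pairs (bits' g)) = N * alpha.
Proof.
rewrite (Ex_sum _ _ (fun ij g => (twins ij.1 ij.2 (bits' g))%:R)) /N big_distrl/=.
apply: eq_bigr => ij neq; rewrite mul1r.
exact: (Ex_twins (sum_slot_law hp hq) slot_law_bit e0).
Qed.

Lemma Ex_two_twins (i j k l : 'I_n) : i != j -> k != l ->
  EE (fun g => (twins i j (bits' g) && twins k l (bits' g))%:R)
  <= 16 * alpha ^+ 2
     + beta * ((k == i)%:R + (l == i)%:R + (k == j)%:R + (l == j)%:R)
     + alpha * (((k, l) == (i, j))%:R + ((k, l) == (j, i))%:R).
Proof.
move=> ij kl; set F := EE _; rewrite !xpair_eqE.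
have a2 : 0 <= 16 * alpha ^+ 2 by rewrite mulr_ge0 ?sqr_ge0.
have al0 : 0 <= alpha by exact: ltW.
have Fsym (f : {ffun edge n m -> bool * bool} -> bool) :
    (forall g, twins i j (bits' g) && twins k l (bits' g) = f g) ->
    F = EE (fun g => (f g)%:R).
  by move=> fE; apply: eq_Ex => g; rewrite fE.
have Falpha : F <= alpha.
  rewrite /alpha -(Ex_twins (sum_slot_law hp hq) slot_law_bit e0 ij).
  apply: le_Ex => [g|g]; first exact/product_law_ge0/slot_law_ge0.
  by rewrite ler_nat; do 2 case: (twins _ _ _).
have shared a b c : uniq [:: a; b; c] ->
    (forall g, twins i j (bits' g) && twins k l (bits' g)
             = twins a b (bits' g) && twins a c (bits' g)) -> F <= beta.
  move=> us /Fsym ->.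
  exact: (Ex_twins_shared slot_law_ge0 (sum_slot_law hp hq) slot_law_bit e0).
set s := (X in beta * X); set d := (X in alpha * X).
have s0 : 0 <= s by rewrite !addr_ge0.
have d0 : 0 <= d by rewrite !addr_ge0.
have [same|] := boolP (((k == i) && (l == j)) || ((k == j) && (l == i))).
  apply: (le_trans Falpha); apply: ler_wpDl; first exact/addr_ge0/mulr_ge0.
  by rewrite ler_peMr// /d -natrD ler1n; case/orP: same => ->; rewrite ?addn1.
rewrite negb_or !negb_and => /andP[kilj kjli].
apply: ler_wpDr; first by rewrite mulr_ge0.
have [meet|] := boolP [|| k == i, l == i, k == j | l == j].
  apply: (@le_trans _ _ beta); last first.
    apply: ler_wpDl => //; rewrite ler_peMr// /s -!natrD ler1n.
    by move: meet; do 4 case: (_ == _).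
  have us a b c : a != b -> a != c -> b != c -> uniq [:: a; b; c].
    by move=> ab ac bc; rewrite /= !inE negb_or ab ac bc.
  case/or4P: meet => /eqP e.
  - subst k; rewrite eqxx/= in kilj.
    by apply: (shared i j l) => //; rewrite us// eq_sym.
  - subst l; rewrite eqxx orbF in kjli.
    apply: (shared i j k) => [|g]; last by rewrite [twins k i _]twinsC.
    by rewrite us// eq_sym.
  - subst k; rewrite eqxx/= in kjli.
    apply: (shared j i l) => [|g]; last by rewrite [twins i j _]twinsC.
    by rewrite us// eq_sym.
  - subst l; rewrite eqxx orbF in kilj.
    apply: (shared j i k) => [|g]; last first.
      by rewrite [twins i j _]twinsC [twins k j _]twinsC.
    by rewrite us// eq_sym.
rewrite !negb_or => /and4P[ki li kj lj].
apply: ler_wpDr; first by rewrite mulr_ge0.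
apply: le_trans (disjoint_le n_gt3).
apply: (Ex_twins_disjoint slot_law_ge0 (sum_slot_law hp hq) slot_law_bit e0).
by rewrite /= !inE !negb_or ij kl andbT/= !(eq_sym _ k) !(eq_sym _ l) ki li kj lj.
Qed.


(** The square is expanded over two ordered pairs. For fixed (i, j), summing the indicators over all
    (k, l) gives 4n for a shared user and 2 for equality. *)
Lemma twin_pairs_sqr_le :
  EE (fun g => twin_pairs (bits' g) ^+ 2)
  <= 16 * alpha ^+ 2 * N ^+ 2 + 4 * beta * N * n%:R + 2 * alpha * N.
Proof.
have sum1 (i : 'I_n) : \sum_(kl : 'I_n * 'I_n) (kl.1 == i)%:R = n%:R :> R.
  rewrite -(pair_bigA _ (fun k l => (k == i)%:R))/= exchange_big/=.
  by under eq_bigr do rewrite sum_eq1; rewrite sumr_const card_ord.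
have sum2 (i : 'I_n) : \sum_(kl : 'I_n * 'I_n) (kl.2 == i)%:R = n%:R :> R.
  rewrite -(pair_bigA _ (fun k l => (l == i)%:R))/=.
  by under eq_bigr do rewrite sum_eq1; rewrite sumr_const card_ord.
rewrite (@eq_Ex _ _ _ _ (fun g => \sum_(ij : 'I_n * 'I_n | ij.1 != ij.2)
    \sum_(kl : 'I_n * 'I_n | kl.1 != kl.2)
      (twins ij.1 ij.2 (bits' g) && twins kl.1 kl.2 (bits' g))%:R)); last first.
  move=> g; rewrite expr2 big_distrlr/=; apply: eq_bigr => ij _.
  by apply: eq_bigr => kl _; rewrite -natrM mulnb.
rewrite Ex_sum; apply: (@le_trans _ _ (\sum_(ij : 'I_n * 'I_n | ij.1 != ij.2)
    (16 * alpha ^+ 2 * N + beta * (4 * n%:R) + alpha * 2))); last first.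
  rewrite -[X in \sum_(_ | _) X]mul1r -big_distrl/= -/N.
  by rewrite le_eqVlt; apply/orP; left; apply/eqP; ring.
apply: ler_sum => ij neq; rewrite Ex_sum.
pose s kl : R := (kl.1 == ij.1)%:R + (kl.2 == ij.1)%:R + (kl.1 == ij.2)%:R
  + (kl.2 == ij.2)%:R.
pose d kl : R := (kl == ij)%:R + (kl == (ij.2, ij.1))%:R.
apply: (@le_trans _ _ (\sum_(kl : 'I_n * 'I_n | kl.1 != kl.2)
    (16 * alpha ^+ 2 + beta * s kl + alpha * d kl))).
  apply: ler_sum => -[k l] kl; apply: le_trans (Ex_two_twins neq kl) _.
  by rewrite -surjective_pairing.
have sumE (F : 'I_n * 'I_n -> R) c r : 0 <= c -> (forall kl, 0 <= F kl) ->
    \sum_kl F kl = r -> \sum_(kl | kl.1 != kl.2) c * F kl <= c * r.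
  by move=> c0 F0 <-; rewrite -big_distrr/= ler_wpM2l// le_sum_pred.
rewrite !big_split/= lerD//; first rewrite lerD//.
- by rewrite /N big_distrr/=; under [leRHS]eq_bigr do rewrite mulr1.
- apply: sumE => // [kl|]; first by rewrite !addr_ge0.
  by rewrite !big_split/= !sum1 !sum2; ring.
- apply: sumE => [|kl|]; [exact: ltW|by rewrite addr_ge0|].
  by rewrite big_split/= !sum_eq1.
Qed.

Lemma Pr_has_twins_ge :
  1 <= n%:R ^+ 2 * (coincidence 2 P ^+ n * coincidence 2 Q ^+ m) ->
  43^-1 <= Pr (@model_law R n m p q)
    (fun o => has_twins [ffun e => o.1.1 e && o.1.2 e]).
Proof.
move=> big.
have x4 : 4 <= n%:R :> R by rewrite ler_nat.
(* Lowering the exponent from n to n - 2 can only increase the power, as its base is at most 1. *)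
have big' : 1 <= n%:R ^+ 2 * alpha.
  apply: (le_trans big); apply: ler_wpM2l; first exact: sqr_ge0.
  apply: ler_wpM2r; first exact/exprn_ge0/ltW.
  by apply: ler_wiXn2l; [exact: ltW|exact: coincidence2_le1|exact: leq_subr].
have N_gt0 : 0 < N by rewrite NE; nra.
apply: (@le_trans _ _ (Pr (product_law w) (fun g => twin_pairs (bits' g) != 0))).
  apply: second_moment; rewrite ?Ex_twin_pairs.
  - exact/product_law_ge0/slot_law_ge0.
  - exact: mulr_gt0 N_gt0 alpha_gt0.
  apply: (le_trans twin_pairs_sqr_le).
  exact: (second_moment_arith x4 NE alpha_gt0 beta_ge0 (beta_sqr_le (ltnW n_gt3)) big').
rewrite [leRHS]PrE.
have -> : Ex (@model_law R n m p q)
      (fun o => (has_twins [ffun e => o.1.1 e && o.1.2 e])%:R) =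
    Ex (product_law w) (fun g => (has_twins (bits' g))%:R).
  rewrite -(Ex_model p q (fun g => (has_twins (bits' g))%:R)).
  apply: eq_Ex => o; congr (has_twins _)%:R; apply/ffunP => e.
  by rewrite !ffunE.
rewrite -PrE; apply: le_Pr => [g|g]; first exact/product_law_ge0/slot_law_ge0.
apply: contraNT => /existsPn h; rewrite /twin_pairs big1// => ij neq.
by move: (h ij); rewrite neq => /= /negbTE ->.
Qed.

End TwinPairs.

(** * Passage to the limit inferior and conclusion *)

Lemma limn_einf_gt0 (R : realType) (u : nat -> R) (c : R) : 0 < c ->
  (\forall n \near \oo%classic, c <= u n) -> (0 < limn_einf (fun n => (u n)%:E))%E.
Proof.
move=> c0 [k _ hk]; rewrite limn_einf_lim.
apply: (@lt_le_trans _ _ c%:E); first by rewrite lte_fin.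
apply: lime_ge; first exact: is_cvg_einfs.
exists k => // l /= kl; apply: le_ereal_inf_tmp => _ [i /= li <-].
by rewrite lee_fin; apply: hk; exact: leq_trans li.
Qed.

Local Open Scope classical_set_scope.
Local Open Scope ring_scope.

Theorem theorem3 (R : realType) (m : nat -> nat)
    (p q : nat -> bool -> bool -> R)
    (hp : forall n, is_prob_vector (p n))
    (hq : forall n, is_prob_vector (q n))
    (hcorr : forall n, positively_correlated_pair n (m n) (p n) (q n))
    (hlim :
      (fun n : nat =>
         - n%:R * ln (1 - 2 * p n true true + 2 * p n true true ^+ 2)
         - (m n)%:R * ln (1 - 2 * q n true true + 2 * q n true true ^+ 2)
         - 2 * ln n%:R) @ \oo --> -oo)
    (est : forall n, graph n (m n) -> graph n (m n) -> 'S_n) :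
  (0 < limn_einf (fun n => (error_prob (p n) (q n) (est n))%:E))%E.
Proof.
(* 86 = 2 * 43: twins occur with probability at least 1/43, and the error probability is at least
   half of that. *)
apply: (@limn_einf_gt0 _ _ (86^-1)); first by rewrite invr_gt0.
near=> n.
have n3 : (3 < n)%N by near: n; exists 4%N.
have := error_prob_has_twins (hp n) (hq n)
  (positive_correlation_law (hp n) (hq n) (hcorr n)) (est n).
have co_gt0 (r : R) : 0 < coincidence 2 r.
  by rewrite (lt_le_trans _ (coincidence2_ge r)).
have n_gt0 : 0 < n%:R :> R by rewrite ltr0n (ltn_trans _ n3).
have : 1 <= n%:R ^+ 2 * (coincidence 2 (p n true true) ^+ n
                          * coincidence 2 (q n true true) ^+ m n).
  (* In logarithms the claim says that the sequence in [hlim] is nonpositive at n, which holds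
     eventually since it tends to minus infinity. *)
  rewrite -ler_ln ?posrE ?ltr01//; last by rewrite !mulr_gt0 ?exprn_gt0.
  rewrite ln1 !lnM ?posrE ?mulr_gt0 ?exprn_gt0// !lnXn//.
  have : - n%:R * ln (coincidence 2 (p n true true))
         - (m n)%:R * ln (coincidence 2 (q n true true)) - 2 * ln n%:R <= 0 :> R.
    by rewrite !coincidence2E; near: n; exact: cvgrNy_le.
  rewrite mulNr !mulr_natl.
  by move: (ln n%:R) (ln _ *+ m n) (ln _ *+ n) => a b c; lra.
by move=> /(Pr_has_twins_ge (hp n) (hq n) n3); lra.
Unshelve. all: by end_near.
Qed.
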